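(* For $1\le k\le n$, the space $U([n],k)$ is a strong deformation retract of $S^{2n}\setminus T^{n-k+1}$; and for $2\le k\le n$, the space $U([n]-\{k-1\},k)$ is a strong deformation retract of $S^{2n-2}\setminus T^{n-k+1}$.
   Context: Let $S^{2n}=\{(z_1,\dots,z_n,x)\in\mathbb{C}^n\times\mathbb{R}:|z_1|^2+\cdots+|z_n|^2+x^2=1\}$ with orbit map (for the coordinatewise $T^n$-action on the $z_i$) $\pi(z_1,\dots,z_n,x)=(|z_1|,\dots,|z_n|,x)$ onto $Q^n=\{(x_1,\dots,x_n,x)\in\mathbb{R}^{n+1}:x_1^2+\cdots+x_n^2+x^2=1,\ x_i\ge0\}$. The manifold with corners $Q^n$ has as faces: $Q^n$ itself, the sets obtained by setting some of $x_1,\dots,x_n$ (fewer than $n$ of them) equal to $0$, and the two vertices $(0,\dots,0,\pm1)$. Its edges are $E_i=\{(0,\dots,0,x_i,0,\dots,0,x)\in Q^n\}$, $i=1,\dots,n$. For $1\le k\le n$, $V([n],k)$ is the union of all faces of $Q^n$ that do not contain all of the edges $E_k,\dots,E_n$, and $U([n],k)=\pi^{-1}(V([n],k))$. For $2\le k\le n$, let $V([n]-\{k-1\})=\{x_{k-1}=0\}\subset Q^n$ be the facet not containing $E_{k-1}$, $V([n]-\{k-1\},k)$ the union of all faces of this facet that do not contain all of $E_k,\dots,E_n$, and $U([n]-\{k-1\},k)=\pi^{-1}(V([n]-\{k-1\},k))$. Here $S^{2n-2}=\pi^{-1}(V([n]-\{k-1\}))=\{z_{k-1}=0\}\subset S^{2n}$.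 $T^{n-k+1}$ denotes the orbit $\pi^{-1}(z)$ of a point $z$ in the relative interior of the face $\{x_1=\cdots=x_{k-1}=0\}$ of $Q^n$ (the smallest face containing $E_k,\dots,E_n$) with last coordinate $x=0$; it is an $(n-k+1)$-dimensional torus, contained in $S^{2n-2}$ when $k\ge2$. *)

(* Defs.v *)
From mathcomp Require Import all_boot all_order all_algebra.
From mathcomp Require Import all_classical all_reals all_analysis.
From mathcomp Require Import complex.

Set Implicit Arguments.
Unset Strict Implicit.
Unset Printing Implicit Defensive.

Import Order.TTheory GRing.Theory Num.Theory.
Import numFieldNormedType.Exports.

Local Open Scope classical_set_scope.
Local Open Scope ring_scope.

(* C^n x R; the regular algebra R[i]^o carries the topology of the modulus,
   and the ambient type carries the product topology. *)
Definition CnR (R : realType) (n : nat) : Type := ('rV[R[i]^o]_n * R)%type.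

Definition RnR (R : realType) (n : nat) : Type := ('rV[R]_n * R)%type.

(* X and A are regarded with the topologies induced from the ambient space T;
   the values of H outside X x [0, 1] are irrelevant. *)
Definition strong_deformation_retract (R : realType) (T : topologicalType)
    (A X : set T) : Prop :=
  A `<=` X /\
  exists H : T * R -> T,
    [/\ {within X `*` `[0, 1], continuous H},
        forall x (t : R), X x -> 0 <= t <= 1 -> X (H (x, t)),
        forall x, X x -> H (x, 0) = x,
        forall x, X x -> A (H (x, 1)) &
        forall a (t : R), A a -> 0 <= t <= 1 -> H (a, t) = a].

(* Coordinates are indexed by i : 'I_n, the coordinate i being x_(i + 1) (or
   z_(i + 1)) in the usual 1-based numbering. The parameter k below is 1-based,
   so that "k <= i.+1" selects the coordinates numbered k, ..., n. *)

Section Sphere.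
Variables (R : realType) (n : nat).

Definition sphere : set (CnR R n) :=
  [set z : CnR R n |
     \sum_(i < n) ComplexField.Normc.normc (z.1 0 i) ^+ 2 + z.2 ^+ 2 = 1].

Definition Q : set (RnR R n) :=
  [set q : RnR R n | \sum_(i < n) (q.1 0 i) ^+ 2 + q.2 ^+ 2 = 1 /\
           forall i : 'I_n, 0 <= q.1 0 i].

Definition orbit_map (z : CnR R n) : RnR R n :=
  (\row_i ComplexField.Normc.normc (z.1 0 i), z.2).

Definition orbit_preimage (V : set (RnR R n)) : set (CnR R n) :=
  sphere `&` orbit_map @^-1` V.

Definition coord_face (I : {set 'I_n}) : set (RnR R n) :=
  [set q : RnR R n | Q q /\ forall i, i \in I -> q.1 0 i = 0].

Definition is_face (F : set (RnR R n)) : Prop :=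
  (exists2 I : {set 'I_n}, (#|I| < n)%N & F = coord_face I) \/
  F = [set ((0, 1) : RnR R n)] \/ F = [set ((0, -1) : RnR R n)].

Definition relint (F : set (RnR R n)) : set (RnR R n) :=
  F `\` \bigcup_(G in [set G | is_face G /\ G `<` F]) G.

Definition edge (i : 'I_n) : set (RnR R n) :=
  [set q : RnR R n | Q q /\ forall j, j != i -> q.1 0 j = 0].

(* The faces of a face G are the faces of Q contained in G; V([n], k) is the
   case G = Q, and V([n] - {k-1}, k) is the case G = facet k.-1. *)
Definition Vfaces (G : set (RnR R n)) (k : nat) : set (RnR R n) :=
  \bigcup_(F in [set F | [/\ is_face F, F `<=` G &
      ~ forall i : 'I_n, (k <= i.+1)%N -> edge i `<=` F]]) F.

Definition facet (j : nat) : set (RnR R n) :=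
  coord_face [set i : 'I_n | i.+1 == j].

Definition face_from (k : nat) : set (RnR R n) :=
  coord_face [set i : 'I_n | (i.+1 < k)%N].

End Sphere.

Arguments sphere R n : clear implicits.
Arguments Q R n : clear implicits.
Arguments facet R n j : clear implicits.
Arguments face_from R n k : clear implicits.

(* Main.v *)
Require Import Defs.
From mathcomp Require Import all_boot all_order all_algebra.
From mathcomp Require Import all_classical all_reals all_analysis.
From mathcomp Require Import complex.

Import Order.TTheory GRing.Theory Num.Theory.
Import numFieldNormedType.Exports.

Local Open Scope classical_set_scope.
Local Open Scope ring_scope.

(* The point p of the relative interior has p_i > 0 exactly for i >= k and last
   coordinate 0, so V([n], k) is the set of q in Q^n having q_i = 0 for some
   i >= k, and similarly inside the facet. Push z away from the orbit of p along
   rays of the quadrant: with u(z) = min {|z_i| / p_i : p_i <> 0}, replace |z_i|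
   by |z_i| - t u(z) p_i without changing arguments, and project back to the
   sphere. This vector vanishes only if (|z_1|, ..., |z_n|) is proportional to p
   and x = 0, i.e. on the removed torus; at t = 1 the coordinate realizing the
   minimum vanishes; and u = 0 as soon as some z_i with i >= k vanishes. *)

Set Implicit Arguments.
Unset Strict Implicit.
Unset Printing Implicit Defensive.

Import ComplexField.Normc.

(** * Entrywise convergence of matrices *)

Lemma cvg_mx (U : topologicalType) (m n : nat) (T : Type) (F : set_system T)
    (FF : Filter F) (f : T -> 'M[U]_(m, n)) (M : 'M[U]_(m, n)) :
  (forall i j, f x i j @[x --> F] --> M i j) -> f @ F --> M.
Proof.
move=> fM A [P MP PA]; suff : \forall x \near F, forall i j, P i j (f x i j).
  by apply: filterS => x Px; exact: PA.
by apply: filter_forall => i; apply: filter_forall => j; exact: fM (MP i j).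
Qed.

Lemma coord_mx_continuous (U : topologicalType) (m n : nat) (i : 'I_m) (j : 'I_n) :
  continuous (fun M : 'M[U]_(m, n) => M i j).
Proof.
(* The implication puts a condition on the entry [(i, j)] alone and leaves the other entries
   free. *)
move=> M A MA; exists (fun i' j' => [set u | (i', j') = (i, j) -> A u]).
  move=> i' j'; have [[-> ->]|ij] := pselect ((i', j') = (i, j)).
    by apply: filterS (MA) => u Au _.
  by apply: filterS filterT => u _ /ij.
by move=> N; apply.
Qed.

(** * Modulus and convergence in the complex plane *)

Section complex_topology.
Variable R : realType.

Lemma normc_real (a : R) : normc a%:C%C = `|a|.
Proof. by rewrite /normc/= expr0n/= addr0 sqrtr_sqr. Qed.

Lemma normc_ge0 (z : R[i]) : 0 <= normc z.
Proof. by case: z => a b; exact: sqrtr_ge0. Qed.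

Lemma ler_dist_normc (x y : R[i]) : `|normc x - normc y| <= normc (x - y).
Proof. by have := ler_dist_dist x y; rewrite -rmorphB lecR normc_real. Qed.

Lemma normc_continuous : continuous (@normc R : R[i]^o -> R).
Proof.
move=> z; have FF : Filter (nbhs (z : R[i]^o)) by exact: nbhs_filter.
apply/cvgrPdist_lt => e e0.
(* Balls of [R[i]^o] have radii in [R[i]], so the real [e] is embedded. *)
have : nbhs (z : R[i]^o) (ball (z : R[i]^o) e%:C%C).
  by apply: nbhsx_ballx; rewrite ltcR.
apply: filterS => w zw; have : `|z - w| < e%:C%C by exact: zw.
by rewrite ltcR; apply: le_lt_trans; exact: ler_dist_normc.
Qed.

Variables (T : Type) (F : set_system T).
Context {FF : Filter F}.

Lemma cvg_normcB (g : T -> R[i]^o) (l : R[i]^o) :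
  normc (l - g x) @[x --> F] --> (0 : R) -> g x @[x --> F] --> l.
Proof.
move=> /cvgrPdist_lt g0; apply/cvgrPdist_lt => -[e e'].
(* A positive element of [R[i]] has imaginary part 0, so the radius is real. *)
rewrite ltcE/= => /andP[/eqP -> /g0]; apply: filterS => x.
by rewrite sub0r normrN ltcR; exact: le_lt_trans (ler_norm _).
Qed.

Lemma cvg_real_complex (s : T -> R) (k : R) :
  s x @[x --> F] --> k -> ((s x)%:C%C : R[i]^o) @[x --> F] --> (k%:C%C : R[i]^o).
Proof.
move=> /cvgrPdist_lt sk; apply: cvg_normcB; apply/cvgrPdist_lt => e /sk.
by apply: filterS => x; rewrite -rmorphB normc_real sub0r normrN normr_id.
Qed.

Lemma cvg_real_complexM (s : T -> R) (k : R) (g : T -> R[i]^o) (z : R[i]^o) :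
  s x @[x --> F] --> k -> g x @[x --> F] --> z ->
  ((s x)%:C%C * g x : R[i]^o) @[x --> F] --> (k%:C%C * z : R[i]^o).
Proof. by move=> /cvg_real_complex sk; exact: cvgZ. Qed.

(* [d] is allowed to be discontinuous at the zeros of [g]. *)
Lemma cvg_bounded_complexM (d : T -> R) (g : T -> R[i]^o) (k : R) :
  (forall x, `|d x| <= 1) -> g x @[x --> F] --> (0 : R[i]^o) ->
  ((d x)%:C%C * g x : R[i]^o) @[x --> F] --> (k%:C%C * 0 : R[i]^o).
Proof.
move=> d1 g0; rewrite mulr0; apply: cvg_normcB; under eq_fun do rewrite sub0r normcN.
apply: (@squeeze_cvgr _ _ _ _ (fun=> 0) (fun x => normc (g x))).
- apply: nearW => x; rewrite normcM normc_real.
  by rewrite mulr_ge0 ?ler_piMl ?normr_ge0 ?normc_ge0.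
- exact: cvg_cst.
- by rewrite -(normc0 R); apply: continuous_cvg g0; exact: normc_continuous.
Qed.

End complex_topology.

(** * Radial push away from the orbit over a unit vector, and renormalization *)

Section radial_push.
Variables (R : realType) (n : nat) (p : 'I_n -> R).
Hypotheses (p_ge0 : forall i, 0 <= p i) (p_unit : \sum_i p i ^+ 2 = 1).

Local Notation T := ('rV[R[i]^o]_n * R)%type.
Implicit Types (z : T) (t : R).

Definition radius z i : R := normc (z.1 0 i).
Definition sqnorm z : R := \sum_i radius z i ^+ 2 + z.2 ^+ 2.
(* The default value 1 may be smaller than every ratio; then [p <= radius z],
   which on the unit sphere forces [z] to lie over [p] ([centre_dominate]). *)
Definition minratio z : R := \big[Num.min/1]_(i | p i != 0) (radius z i / p i).
(* Equal to 0 when [radius z i = 0], and possibly discontinuous there. *)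
Definition shrink z i : R := minratio z * p i / radius z i.
(** The product of [shrink] and the coordinate is kept together: it is continuous even where the
    coordinate vanishes. *)
Definition push (zt : T * R) : T :=
  (\row_i (zt.1.1 0 i - zt.2%:C%C * ((shrink zt.1 i)%:C%C * zt.1.1 0 i)),
   zt.1.2).
Definition normalize z : T :=
  (\row_i (((Num.sqrt (sqnorm z))^-1)%:C%C * z.1 0 i),
   (Num.sqrt (sqnorm z))^-1 * z.2).

Lemma radius_ge0 z i : 0 <= radius z i.
Proof. exact: normc_ge0. Qed.

Lemma minratio_ge0 z : 0 <= minratio z.
Proof. by apply: le_bigmin => // i _; rewrite divr_ge0 ?radius_ge0. Qed.

Lemma minratio_le z i : p i != 0 -> minratio z <= radius z i / p i.
Proof. by move=> pi; apply: (bigmin_le_cond 1 (P := fun i => p i != 0)). Qed.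

Lemma minratio_le_radius z i : minratio z * p i <= radius z i.
Proof.
have [->|pi] := eqVneq (p i) 0; first by rewrite mulr0 radius_ge0.
by rewrite -ler_pdivlMr ?lt_def ?pi ?p_ge0//; exact: minratio_le.
Qed.

Lemma shrink_radius z i : shrink z i * radius z i = minratio z * p i.
Proof.
rewrite /shrink; have [r0|?] := eqVneq (radius z i) 0; last by rewrite divfK.
(* When the radius is 0, [minratio z * p i] is squeezed between 0 and that radius. *)
apply/esym/eqP; rewrite r0 mulr0 eq_le mulr_ge0 ?minratio_ge0// andbT.
by rewrite -[leRHS]r0 minratio_le_radius.
Qed.

Lemma shrink_ge0 z i : 0 <= shrink z i.
Proof. by rewrite divr_ge0 ?mulr_ge0 ?minratio_ge0 ?radius_ge0. Qed.

Lemma shrink_le1 z i : shrink z i <= 1.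
Proof.
rewrite /shrink; have [->|r0] := eqVneq (radius z i) 0.
  by rewrite invr0 mulr0.
by rewrite ler_pdivrMr ?mul1r ?minratio_le_radius// lt_def r0 radius_ge0.
Qed.

(** The coordinate is multiplied by the real [1 - t * shrink z i], which is nonnegative since [t]
    and [shrink z i] lie in [0, 1]. *)
Lemma radius_push z t i : 0 <= t <= 1 ->
  radius (push (z, t)) i = radius z i - t * minratio z * p i.
Proof.
move=> /andP[t0 t1]; rewrite {1}/radius /push/= mxE mulrA -rmorphM/=.
rewrite -[X in normc (X - _)]mul1r -mulrBl -[1]/(1%:C%C) -rmorphB normcM normc_real.
rewrite ger0_norm ?subr_ge0; last by rewrite mulr_ile1 ?shrink_ge0 ?shrink_le1.
rewrite -[normc _]/(radius z i) mulrBl mul1r.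
by rewrite -[t * shrink z i * _]mulrA shrink_radius mulrA.
Qed.

Lemma radius_normalize z i :
  radius (normalize z) i = (Num.sqrt (sqnorm z))^-1 * radius z i.
Proof.
rewrite /radius /normalize/= mxE normcM normc_real.
by rewrite ger0_norm ?invr_ge0 ?sqrtr_ge0.
Qed.

Lemma sqnorm_ge0 z : 0 <= sqnorm z.
Proof. by rewrite addr_ge0 ?sqr_ge0// sumr_ge0// => i _; rewrite sqr_ge0. Qed.

Lemma sqnorm_normalize z : sqnorm z != 0 -> sqnorm (normalize z) = 1.
Proof.
move=> z0; rewrite {1}/sqnorm.
under eq_bigr do rewrite radius_normalize exprMn.
rewrite -mulr_sumr exprMn -mulrDr exprVn sqr_sqrtr ?sqnorm_ge0//.
exact: mulVf.
Qed.

Lemma normalize_id z : sqnorm z = 1 -> normalize z = z.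
Proof.
move=> z1; rewrite /normalize z1 sqrtr1 invr1 mul1r [RHS]surjective_pairing.
by congr pair; apply/rowP => i; rewrite mxE mul1r.
Qed.

Lemma push0 z : push (z, 0) = z.
Proof.
rewrite /push/= [RHS]surjective_pairing.
by congr pair; apply/rowP => i; rewrite mxE mul0r subr0.
Qed.

Lemma push_fix z t i : p i != 0 -> z.1 0 i = 0 -> push (z, t) = z.
Proof.
move=> pi zi; have m0 : minratio z = 0.
  apply/eqP; rewrite eq_le minratio_ge0 andbT.
  by apply: le_trans (minratio_le z pi) _; rewrite /radius zi normc0 mul0r.
rewrite /push/= [RHS]surjective_pairing.
by congr pair; apply/rowP => j; rewrite mxE /shrink m0 !mul0r mulr0 subr0.
Qed.

(** The orbit over [(p, 0)], that is, the removed torus. *)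
Definition centre : set T := [set z | (forall i, radius z i = p i) /\ z.2 = 0].

(** Both [z] and [p] have norm 1, which forces [c ^+ 2 = 1]. *)
Lemma centre_ray z c : sqnorm z = 1 -> z.2 = 0 -> 0 <= c ->
  (forall i, radius z i = c * p i) -> centre z.
Proof.
move=> z1 z2 c0 zc; suff c1 : c = 1 by split => // i; rewrite zc c1 mul1r.
have c2 : c ^+ 2 = 1.
  rewrite -[RHS]z1 /sqnorm z2 expr0n addr0.
  by under eq_bigr do rewrite zc exprMn; rewrite -mulr_sumr p_unit mulr1.
by apply/eqP; rewrite -(@eqrXn2 _ 2)// c2 expr1n.
Qed.

(** The differences of squares and [z.2 ^+ 2] are nonnegative with sum 1 - 1 = 0, so each of them
    vanishes. *)
Lemma centre_dominate z : sqnorm z = 1 -> (forall i, p i <= radius z i) -> centre z.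
Proof.
move=> z1 pz.
have d0 i : 0 <= radius z i ^+ 2 - p i ^+ 2.
  by rewrite subr_ge0 lerXn2r ?nnegrE ?radius_ge0.
have : \sum_i (radius z i ^+ 2 - p i ^+ 2) + z.2 ^+ 2 = 0.
  by rewrite sumrB p_unit addrAC -[X in X - 1]/(sqnorm z) z1 subrr.
move/eqP; rewrite paddr_eq0 ?sqr_ge0 ?sumr_ge0// sqrf_eq0 => /andP[+ /eqP z2].
rewrite psumr_eq0// => /allP rp; split => // i; apply/eqP.
by rewrite -(@eqrXn2 _ 2) ?radius_ge0// -subr_eq0; apply: rp; rewrite mem_index_enum.
Qed.

Lemma sqnorm_push z t : 0 <= t <= 1 -> sqnorm z = 1 -> ~ centre z ->
  sqnorm (push (z, t)) != 0.
Proof.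
move=> t01 z1; apply: contra_not_neq => /eqP.
rewrite paddr_eq0 ?sqr_ge0 ?sumr_ge0// => [|i _]; last by rewrite sqr_ge0.
rewrite sqrf_eq0 psumr_eq0 => [|i _]; last by rewrite sqr_ge0.
(* A zero image means [radius z i = t * minratio z * p i] for all [i], which puts [z] on the ray
   through [p]. *)
move=> /andP[/allP w0 /eqP z2]; apply: (@centre_ray _ (t * minratio z)) => //.
  by rewrite mulr_ge0 ?minratio_ge0//; case/andP: t01.
move=> i; apply/eqP; rewrite -subr_eq0 -radius_push// -sqrf_eq0.
by apply: w0; rewrite mem_index_enum.
Qed.

Lemma not_centre_push z t : 0 <= t <= 1 -> sqnorm z = 1 -> ~ centre z ->
  ~ centre (normalize (push (z, t))).
Proof.
move=> t01 z1 zc [wp w2]; apply: zc.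
have := sqnorm_push t01 z1; set w := push (z, t) in wp w2 *.
have [w0|w0 _] := eqVneq (sqnorm w) 0; first by move=> nc; apply: contrapT => /nc.
have N0 : 0 < Num.sqrt (sqnorm w) by rewrite sqrtr_gt0 lt_def w0 sqnorm_ge0.
move: w2 => /= /eqP; rewrite mulf_eq0 invr_eq0 gt_eqF//= => /eqP w2.
(* With N the norm of [w], solving [N^-1 * (radius z i - t * minratio z * p i) = p i] for
   [radius z i] gives this factor. *)
apply: (@centre_ray _ (Num.sqrt (sqnorm w) + t * minratio z)) => //.
  by rewrite addr_ge0 ?(ltW N0)// mulr_ge0 ?minratio_ge0//; case/andP: t01.
move=> i; have := wp i.
rewrite radius_normalize radius_push// => /(canRL (mulVKf (lt0r_neq0 N0))).
by move/eqP; rewrite subr_eq -mulrDl => /eqP.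
Qed.

Lemma push1 z : sqnorm z = 1 -> ~ centre z ->
  exists2 i, p i != 0 & (push (z, 1)).1 0 i = 0.
Proof.
(* Either the default 1 is at most [minratio z], and then [p i <= minratio z * p i <= radius z i],
   or some ratio attains the minimum. *)
move=> z1 zc; have /bigmin_leP[m1|[i pi im]] := lexx (minratio z).
  case: zc; apply: centre_dominate => // i.
  apply: le_trans (minratio_le_radius z i).
  by rewrite ler_peMl.
exists i => //; apply: (@eq0_normc R).
rewrite -[LHS]/(radius _ _) radius_push ?lexx ?ler01//.
apply/eqP; rewrite mul1r subr_eq0 eq_le minratio_le_radius andbT.
by rewrite -ler_pdivrMr// lt_def pi p_ge0.
Qed.

(** * Continuity of the push and of the normalization *)

Lemma coord_continuous i : continuous (fun z : T => z.1 0 i : R[i]^o).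
Proof.
move=> z; have z1 : (w.1 : 'rV[R[i]^o]_n) @[w --> z] --> z.1 by exact: cvg_fst.
exact: (cvg_comp _ _ z1 (@coord_mx_continuous R[i]^o 1 n 0 i z.1)).
Qed.

Lemma radius_continuous i : continuous (radius^~ i).
Proof.
move=> z.
exact: (cvg_comp _ _ (@coord_continuous i z) (@normc_continuous R (z.1 0 i))).
Qed.

Lemma minratio_continuous : continuous minratio.
Proof.
move=> z; apply: cvg_big => [|i pi]; first exact: min_continuous.
by apply: cvgM; [exact: radius_continuous|exact: cvg_cst].
Qed.

Lemma sqnorm_continuous : continuous sqnorm.
Proof.
move=> z; apply: cvgD; last by apply: cvgM; exact: cvg_snd.
apply: cvg_big => [|i _]; first exact: add_continuous.
by apply: cvgM; exact: radius_continuous.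
Qed.

(** Where the radius vanishes, a factor bounded by 1 multiplies a coordinate tending to 0; elsewhere
    [shrink] is itself continuous. *)
Lemma shrink_coord_continuous i :
  continuous (fun z : T => (shrink z i)%:C%C * z.1 0 i : R[i]^o).
Proof.
move=> z; have [r0|r0] := eqVneq (radius z i) 0.
  have zi : z.1 0 i = 0 by exact: eq0_normc r0.
  rewrite /continuous_at zi; apply: cvg_bounded_complexM => [w|].
    by rewrite ger0_norm ?shrink_ge0 ?shrink_le1.
  by rewrite -zi; exact: coord_continuous.
apply: cvg_real_complexM; last exact: coord_continuous.
apply: cvgM; last by apply: cvgV => //; exact: radius_continuous.
by apply: cvgM; [exact: minratio_continuous|exact: cvg_cst].
Qed.

Lemma push_continuous : continuous push.
Proof.
move=> zt; have zt1 : (w.1 : T) @[w --> zt] --> zt.1 by exact: cvg_fst.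
apply: (@cvg_pair _ _ _ _ (nbhs (push zt).1) (nbhs (push zt).2)); last first.
  exact: (cvg_comp _ _ zt1 cvg_snd).
apply: cvg_mx => j i; rewrite mxE; under eq_fun do rewrite mxE.
apply: (@cvgB _ R[i]^o).
  exact: (cvg_comp _ _ zt1 (@coord_continuous i zt.1)).
apply: cvg_real_complexM; first exact: cvg_snd.
exact: (cvg_comp _ _ zt1 (@shrink_coord_continuous i zt.1)).
Qed.

Lemma normalize_continuous z : sqnorm z != 0 -> {for z, continuous normalize}.
Proof.
move=> z0; have cN : (Num.sqrt (sqnorm w))^-1 @[w --> z] --> (Num.sqrt (sqnorm z))^-1.
  apply: cvgV; first by rewrite gt_eqF// sqrtr_gt0 lt_def z0 sqnorm_ge0.
  exact: (cvg_comp _ _ (@sqnorm_continuous z) (@sqrt_continuous R _)).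
apply: (@cvg_pair _ _ _ _ (nbhs (normalize z).1) (nbhs (normalize z).2)); last first.
  by apply: cvgM => //; exact: cvg_snd.
apply: cvg_mx => j i; rewrite mxE; under eq_fun do rewrite mxE.
by apply: cvg_real_complexM => //; exact: coord_continuous.
Qed.

(** [J] lets one statement serve the sphere ([J] empty) and the subsphere over a facet: the homotopy
    multiplies each complex coordinate by a real, so vanishing coordinates stay 0. *)
Lemma radial_retract (J : {set 'I_n}) :
  strong_deformation_retract R
    [set z : T | [/\ sqnorm z = 1, forall j, j \in J -> z.1 0 j = 0 &
                     exists2 i, p i != 0 & z.1 0 i = 0]]
    [set z : T | [/\ sqnorm z = 1, forall j, j \in J -> z.1 0 j = 0 & ~ centre z]].
Proof.
split=> [z [z1 zJ [i pi zi]]|].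
  by split=> // -[zp _]; move: pi; rewrite -zp /radius zi normc0 eqxx.
exists (normalize \o push); split => /=.
- apply: continuous_in_subspaceT => -[z t]; rewrite inE => -[/= [z1 _ zc]].
  rewrite in_itv/= => t01.
  exact: (cvg_comp _ _ (@push_continuous (z, t))
    (@normalize_continuous (push (z, t)) (sqnorm_push t01 z1 zc))).
- move=> z t [z1 zJ zc] t01; split.
  + exact/sqnorm_normalize/sqnorm_push.
  + by move=> j jJ; rewrite !mxE zJ// !mulr0 subrr mulr0.
  + exact: not_centre_push.
- by move=> z [z1 _ _]; rewrite push0 normalize_id.
- move=> z [z1 zJ zc]; have t01 : 0 <= (1 : R) <= 1 by rewrite ler01 lexx.
  split; first exact/sqnorm_normalize/sqnorm_push.
    by move=> j jJ; rewrite !mxE zJ// !mulr0 subrr mulr0.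
  have [i pi wi] := push1 z1 zc; exists i => //.
  by rewrite mxE wi mulr0.
- by move=> z t [z1 _ [i pi zi]] _; rewrite (push_fix _ pi zi) normalize_id.
Qed.

End radial_push.

(** * Faces of the orbit space and preimages under the orbit map *)

Section faces.
Variables (R : realType) (n : nat).
Implicit Types (q : RnR R n) (z : CnR R n) (J : {set 'I_n}).

(** The midpoint of the edge [i], used to test whether a face contains that edge. *)
Let axis (i : 'I_n) : RnR R n := (delta_mx 0 i, 0).

Lemma edge_axis i : edge i (axis i).
Proof.
split=> [|j ji]; last by rewrite mxE (negbTE ji) andbF.
split=> [|j]; last by rewrite mxE; case: (_ && _).
rewrite expr0n addr0 (bigD1 i)//= mxE !eqxx expr1n big1 ?addr0// => j ji.
by rewrite mxE (negbTE ji) andbF expr0n.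
Qed.

Lemma edge_sub_coord_face i J : i \notin J -> edge i `<=` @coord_face R n J.
Proof.
by move=> iJ q [Qq qi]; split=> // j jJ; apply: qi; apply: contraNneq iJ => <-.
Qed.

Lemma edge_sub_notin i J : edge i `<=` @coord_face R n J -> i \notin J.
Proof.
move=> /(_ _ (edge_axis i))[_ iJ]; apply/negP => /iJ/eqP.
by rewrite mxE !eqxx oner_eq0.
Qed.

(** For [q] in [Q], this indexes the smallest coordinate face through [q]. *)
Definition zeros q : {set 'I_n} := [set i | q.1 0 i == 0].

Lemma zerosP q : Q R n q -> (#|zeros q| < n)%N \/ q = (0, 1) \/ q = (0, -1).
Proof.
case: q => q x Qq; have [lt_n|ge_n] := ltnP #|zeros (q, x)| n; [by left|right].
have q0 : q = 0.
  apply/rowP => i; rewrite mxE; apply/eqP.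
  have /setP/(_ i) : zeros (q, x) = [set: 'I_n]%SET.
    by apply/eqP; rewrite eqEcard finset.subsetT cardsT card_ord.
  by rewrite !inE.
move: Qq => [/= + _]; rewrite q0 big1 => [|i _]; last by rewrite mxE expr0n.
by rewrite add0r => /eqP; rewrite sqrf_eq1 => /orP[]/eqP ->; [left|right].
Qed.

Lemma coord_face_zeros q : Q R n q -> coord_face (zeros q) q.
Proof. by move=> Qq; split=> // i; rewrite inE => /eqP. Qed.

Lemma coord_face_sub_zeros q J :
  coord_face J q -> coord_face (zeros q) `<=` @coord_face R n J.
Proof.
by move=> [_ qJ] q' [Qq' q'0]; split=> // i iJ; apply: q'0; rewrite inE qJ.
Qed.

Lemma coord_face0 : @coord_face R n finset.set0 = Q R n.
Proof. by apply/seteqP; split=> [q []//|q Qq]; split=> // i; rewrite inE. Qed.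

(** A coordinate face contains the edge [i] exactly when [i] is not among its vanishing coordinates.
    For the converse inclusion, the smallest face through a point with coordinate [i] zero omits the
    edge [i]. *)
Lemma VfacesE J (k : nat) : (1 <= k <= n)%N ->
  Vfaces (@coord_face R n J) k =
  [set q | coord_face J q /\ exists2 i : 'I_n, (k <= i.+1)%N & q.1 0 i = 0].
Proof.
move=> /andP[k1 kn].
have n0 : (n.-1 < n)%N by rewrite ltn_predL (leq_trans k1).
apply/seteqP; split=> [q [F [[[I _ FI]|vF] FJ Fk] Fq]|q [Jq [i ki qi]]].
- split; first exact: FJ.
  apply: contrapT => nq; apply: Fk => i ki; rewrite FI.
  apply: edge_sub_coord_face; apply/negP => iI; apply: nq; exists i => //.
  by move: Fq; rewrite FI => -[_]; apply.
- split; first exact: FJ.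
  (* At a vertex all coordinates vanish; the last one, numbered n, satisfies [k <= n]. *)
  exists (Ordinal n0) => /=; first by rewrite (ltn_predK n0).
  by case: vF Fq => -> ->; rewrite mxE.
- have Qq : Q R n q by case: Jq.
  have [zn|qv] := zerosP Qq.
    exists (coord_face (zeros q)); last exact: coord_face_zeros.
    split; first by left; exists (zeros q).
      exact: coord_face_sub_zeros.
    by move=> /(_ i ki)/edge_sub_notin; rewrite inE qi eqxx.
  exists [set q] => //; split.
  + by right; case: qv => ->; [left|right].
  + by move=> _ ->.
  + move=> /(_ i ki (axis i) (edge_axis i)) /= qE.
    move: qi => /eqP; rewrite -qE/= mxE !eqxx.
    by rewrite oner_eq0.
Qed.

(** If a coordinate [i] with [k <= i.+1] vanished, [coord_face (zeros q)] would be a smaller face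
    through [q], as it misses [axis i]. The condition [q.2 = 0] rules out the vertices. *)
Lemma relint_face_from_neq0 (k : nat) q : (1 <= k <= n)%N ->
  relint (face_from R n k) q -> q.2 = 0 ->
  forall i : 'I_n, (q.1 0 i != 0) = (k <= i.+1)%N.
Proof.
move=> /andP[k1 kn] [[Qq qk] nq] q2 i; have [ki|ik] := leqP k i.+1; last first.
  by apply/negbTE; rewrite negbK qk// inE.
apply/negP => /eqP qi; apply: nq.
have [zn|qv] := zerosP Qq; last first.
  by case: qv q2 => -> /= /eqP; rewrite ?oppr_eq0 oner_eq0.
exists (coord_face (zeros q)); last exact: coord_face_zeros.
split; first by left; exists (zeros q).
split; first exact: coord_face_sub_zeros.
move=> /(_ (axis i)); case.
  apply: edge_sub_coord_face (edge_axis i).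
  by rewrite inE -leqNgt.
by move=> _ /(_ i); rewrite inE qi eqxx mxE !eqxx => /(_ isT)/eqP; rewrite oner_eq0.
Qed.

Lemma orbit_map_Q z : sphere R n z -> Q R n (orbit_map z).
Proof.
move=> Sz; split=> [|i]; last by rewrite mxE normc_ge0.
by rewrite -[RHS]Sz; congr (_ + _); apply: eq_bigr => i _; rewrite mxE.
Qed.

Lemma orbit_map_eq0 z i : (orbit_map z).1 0 i = 0 <-> z.1 0 i = 0.
Proof. by rewrite mxE; split=> [/eq0_normc|->]; rewrite ?normc0. Qed.

Lemma orbit_preimage_coord_face J z :
  orbit_preimage (coord_face J) z <->
  sphere R n z /\ forall j, j \in J -> z.1 0 j = 0.
Proof.
split=> [[Sz [_ zJ]]|[Sz zJ]]; split=> //.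
  by move=> j /zJ/orbit_map_eq0.
by split; [exact: orbit_map_Q|move=> j /zJ/orbit_map_eq0].
Qed.

(** This is [radial_retract] with [p] the coordinates of [q]: they are nonzero exactly from number
    [k] on, and [centre] becomes the orbit over [q]. *)
Lemma orbit_preimage_retract J (k : nat) q : (1 <= k <= n)%N ->
  relint (face_from R n k) q -> q.2 = 0 ->
  strong_deformation_retract R
    (orbit_preimage (Vfaces (@coord_face R n J) k))
    (orbit_preimage (coord_face J) `\` orbit_preimage [set q]).
Proof.
move=> hk hq q2; have q0 := relint_face_from_neq0 hk hq q2.
have [Qq q_ge0] : Q R n q by case: hq => -[].
have q_unit : \sum_i q.1 0 i ^+ 2 = 1 by move: Qq; rewrite q2 expr0n addr0.
have := radial_retract q_ge0 q_unit J; congr (strong_deformation_retract _ _ _).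
- rewrite VfacesE//; apply/seteqP; split=> [z [Sz zJ [i qi zi]]|z [Sz [Jz [i ki zi]]]].
    have /orbit_preimage_coord_face[_ Jz] : sphere R n z /\ forall j, j \in J -> z.1 0 j = 0 by [].
    by split=> //; split=> //; exists i; [rewrite -q0|exact/orbit_map_eq0].
  have /orbit_preimage_coord_face[_ zJ] : orbit_preimage (coord_face J) z by [].
  by split=> //; exists i; [rewrite q0|exact/orbit_map_eq0].
- have centreE z : centre (q.1 0) z <-> orbit_map z = q.
    split=> [[zq z2]|zq].
      rewrite [q]surjective_pairing q2 -z2; congr pair.
      by apply/rowP => i; rewrite mxE -zq.
    by split=> [i|]; [rewrite -zq mxE|rewrite -q2 -zq].
  apply/seteqP; split=> [z [Sz zJ zc]|z [/orbit_preimage_coord_face[Sz zJ] zq]].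
    by split=> [|[_ /centreE]//]; exact/orbit_preimage_coord_face.
  by split=> // /centreE zc; apply: zq.
Qed.

End faces.

Unset Implicit Arguments.
Set Strict Implicit.

Theorem lemma3p3 (R : realType) (n k : nat) (hk : (1 <= k <= n)%N)
    (p : RnR R n) (hp : relint (face_from R n k) p) (hp0 : p.2 = 0) :
  strong_deformation_retract R
    (orbit_preimage (Vfaces (Q R n) k))
    (sphere R n `\` orbit_preimage [set p])
  /\
  ((2 <= k)%N ->
   strong_deformation_retract R
     (orbit_preimage (Vfaces (facet R n k.-1) k))
     (orbit_preimage (facet R n k.-1) `\` orbit_preimage [set p])).
Proof.
have sphereE : sphere R n = orbit_preimage (Q R n).
  by apply/seteqP; split=> [z Sz|z []//]; split=> //; exact: orbit_map_Q.
(* A facet is by definition a coordinate face, and [Q] is the one with empty index set. *)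
split=> [|_]; last exact: orbit_preimage_retract.
by rewrite sphereE -coord_face0; exact: orbit_preimage_retract.
Qed.
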